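(* Let $G$ be a finite group. Let $k>2$ and $0<\varepsilon<1$ be constants and let $\delta=(2+k^2\varepsilon)/(k-2)$. Assume $\delta\le 1/4$. Let $A\subseteq G$ be a nonempty subset satisfying $A=A^{-1}$. Then one of the following is true. 1. Given a random $(u,v)\in A\times A$ drawn from the uniform distribution, $uv\notin A$ with probability at least $\varepsilon$. 2. There exists $A'\subseteq A$ with $|A\setminus A'|<2|A|/k$ such that $A'A'$ is a subgroup of $G$. Furthermore, $$|A'A'\setminus A'|\le\frac{\delta}{1-2\delta}|A'|.$$
   Context: $A^{-1}=\{a^{-1}: a\in A\}$ and $A'A'=\{ab: a,b\in A'\}$. *)

(* Defs.v *)
From HB Require Import structures.
From mathcomp Require Import all_boot all_order all_algebra all_fingroup.
From mathcomp Require Import reals.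

Set Implicit Arguments.
Unset Strict Implicit.
Unset Printing Implicit Defensive.

Import Order.TTheory GRing.Theory Num.Theory.
Local Open Scope ring_scope.

(* Since [0^-1 = 0] in a field, the value is 0 when [S] is empty. *)
Definition unif_prob (R : realType) (T : finType) (S : {set T}) (P : pred T) : R :=
  #|[set x in S | P x]|%:R / #|S|%:R.

(* Main.v *)
(** Markov's inequality discards from [A] fewer than [2|A|/k] elements and
    leaves a symmetric set [B] with [|B \ xB| < delta |B|] for every [x] in [B].
    The defect [|B \ xB|] is subadditive in [x], and it is smaller than [|B|]
    exactly when [x] lies in [B B^-1 = B B].  Elements of [B B] have defect
    below [2 delta |B| <= |B|/2], so products of two of them have defect below
    [|B|], which makes [B B] a group.  Its size is bounded by double counting
    the [|B|^2] pairs [(x, b)] with [b] and [x^-1 b] in [B]. *)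
Require Import Defs.
From HB Require Import structures.
From mathcomp Require Import all_boot all_order all_algebra all_fingroup.
From mathcomp Require Import reals.
From mathcomp Require Import ring lra.

Set Implicit Arguments.
Unset Strict Implicit.
Unset Printing Implicit Defensive.

Import Order.TTheory GRing.Theory Num.Theory.
Local Open Scope ring_scope.

Definition defect (gT : finGroupType) (B : {set gT}) (x : gT) : nat :=
  #|B :\: (x *: B)%g|.

Section Defect.
Variables (gT : finGroupType) (B : {set gT}).
Local Open Scope group_scope.

Lemma defectM x y : (defect B (x * y) <= defect B x + defect B y)%N.
Proof.
rewrite /defect -(card_lcoset (B :\: y *: B) x).
apply: leq_trans (leq_card_setU _ _); apply/subset_leq_card/subsetP => z.
rewrite !inE !mem_lcoset in_setD mem_lcoset invMg mulgA => /andP[xyz ->].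
by case: (boolP (_ \in B)); rewrite ?andbT //= orbC xyz.
Qed.

Lemma defect_lt x : (defect B x < #|B|)%N -> x \in B * B^-1.
Proof.
move=> lt_xB.
have /card_gt0P[z] : (0 < #|B :&: x *: B|)%N.
  by rewrite -(ltn_add2r (defect B x)) add0n cardsID.
rewrite inE mem_lcoset => /andP[Bz Bxz].
apply/mulsgP; exists z (x^-1 * z)^-1; rewrite ?mem_invg ?invgK //.
by rewrite invMg invgK mulKVg.
Qed.

(** After exchanging the sums: b lies in xB exactly when x lies in the translate [b *: B^-1], so
    each b in B is counted |B| times. *)
Lemma sum_card_setI_lcoset :
  (\sum_x #|B :&: x *: B| = #|B| * #|B|)%N.
Proof.
transitivity (\sum_x \sum_(b in B) (b \in x *: B))%N.
  apply: eq_bigr => x _; rewrite -sum1_card.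
  rewrite (eq_bigl (fun b => (b \in B) && (b \in x *: B))) => [|b];
    last exact: in_setI.
  by rewrite big_mkcondr; apply: eq_bigr => b _; case: (_ \in _).
rewrite exchange_big /= -sum_nat_const; apply: eq_bigr => b Bb.
rewrite -card_invg -(card_lcoset B^-1 b) -sum1_card [RHS]big_mkcond /=.
apply: eq_bigr => x _; rewrite !mem_lcoset mem_invg invMg invgK.
by case: (_ \in B).
Qed.

End Defect.

Lemma product_group_of_small_defect (R : realFieldType) (gT : finGroupType)
    (d : R) (B : {set gT}) :
    B != set0 -> B = (B^-1)%g -> d <= 1 / 4 ->
    (forall x, x \in B -> (defect B x)%:R < d * #|B|%:R) ->
  group_set (B * B)%g /\
  #|(B * B)%g :\: B|%:R <= d / (1 - 2 * d) * #|B|%:R.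
Proof.
move=> B0 Binv d4 dB.
have n0 : 0 < #|B|%:R :> R by rewrite ltr0n card_gt0.
have dBB x : x \in (B * B)%g -> (defect B x)%:R < 2 * d * #|B|%:R.
  case/mulsgP => a b /dB Ba /dB Bb ->.
  have : (defect B (a * b)%g)%:R <= (defect B a)%:R + (defect B b)%:R :> R.
    by rewrite -natrD ler_nat defectM.
  lra.
split.
  apply/group_setP; split.
    have /set0Pn[b Bb] := B0.
    by apply/mulsgP; exists b b^-1%g; rewrite ?mulgV // -mem_invg -Binv.
  move=> x y /dBB Hx /dBB Hy; rewrite {2}Binv; apply: defect_lt.
  have : (defect B (x * y)%g)%:R <= (defect B x)%:R + (defect B y)%:R :> R.
    by rewrite -natrD ler_nat defectM.
  rewrite -(ltr_nat R); nra.
rewrite mulrAC ler_pdivlMr; last by lra.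
(* The [r x] sum to |B|^2. Each x in B contributes at least (1-d)|B| and each x in BB \ B at least
   (1-2d)|B|; cancelling |B| leaves (1-2d)|BB \ B| <= d|B|. *)
pose r x : R := #|B :&: (x *: B)%g|%:R.
have rE x : r x = #|B|%:R - (defect B x)%:R.
  by rewrite /r -(cardsID (x *: B)%g B) natrD addrK.
have sum_r : \sum_x r x = #|B|%:R * #|B|%:R.
  by rewrite -natr_sum sum_card_setI_lcoset natrM.
have le_B : (1 - d) * #|B|%:R * #|B|%:R <= \sum_(x in B) r x.
  rewrite mulr_natr -sumr_const; apply: ler_sum => x /dB; rewrite rE; lra.
have le_BB : (1 - 2 * d) * #|B|%:R * #|(B * B)%g :\: B|%:R
    <= \sum_(x in (B * B)%g :\: B) r x.
  rewrite mulr_natr -sumr_const; apply: ler_sum => x /setDP[/dBB + _].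
  rewrite rE; lra.
have : \sum_(x in B) r x + \sum_(x in (B * B)%g :\: B) r x <= \sum_x r x.
  rewrite [leRHS](bigID (mem B)) /= lerD2l [leRHS]big_mkcond [leLHS]big_mkcond /=.
  apply: ler_sum => x _; rewrite inE; case: (x \in B) => //=.
  by case: ifP => // _; rewrite /r.
by rewrite sum_r => le_sum; rewrite -(ler_pM2r n0); nra.
Qed.

Lemma markov_sum (R : realFieldType) (T : finType) (S : {set T}) (f : T -> R)
    (t : R) : (forall x, x \in S -> 0 <= f x) ->
  #|[set x in S | t <= f x]|%:R * t <= \sum_(x in S) f x.
Proof.
move=> f0; rewrite mulr_natl -sumr_const.
rewrite [leRHS](bigID (fun x => t <= f x)) /= -[leLHS]addr0 lerD //.
  rewrite (eq_bigl (fun x => (x \in S) && (t <= f x))) => [|x];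
    last by rewrite inE.
  by apply: ler_sum => x /andP[].
by apply: sumr_ge0 => x /andP[/f0].
Qed.

Section ProductDefects.
Variables (gT : finGroupType) (A : {set gT}).
Local Open Scope group_scope.

Definition escapes (x : gT) : nat := #|[set y in A | x * y \notin A]|.

(** The left side is the numerator of [unif_prob] in the theorem, counted by first coordinate. *)
Lemma card_escaping_pairs :
  #|[set p in setX A A | [pred p : gT * gT | p.1 * p.2 \notin A] p]|
    = (\sum_(x in A) escapes x)%N.
Proof.
rewrite -sum1_card.
transitivity (\sum_(x in A) \sum_(y in A | (x * y)%g \notin A) 1)%N.
  by rewrite pair_big_dep /=; apply: eq_bigl => -[x y]; rewrite !inE /= andbA.
apply: eq_bigr => x _; rewrite /escapes -sum1_card.
by apply: eq_bigl => y; rewrite inE.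
Qed.

(** For z in B \ xB, the point x^-1 z is not in B. If it is outside A, then z is counted by
    [escapes x^-1]; otherwise z lies in x(A \ B). *)
Lemma defect_le_escapes (B : {set gT}) x : B \subset A ->
  (defect B x <= escapes x^-1 + #|A :\: B|)%N.
Proof.
move=> sBA; rewrite /defect -(card_lcoset (A :\: B) x).
apply: leq_trans (leq_card_setU _ _); apply/subset_leq_card/subsetP => z.
rewrite !inE !mem_lcoset inE => /andP[Bxz Bz].
by rewrite (subsetP sBA _ Bz) Bxz /= orNb.
Qed.

End ProductDefects.

Theorem theorem5p2 (R : realType) (gT : finGroupType) (G : {group gT})
    (k eps delta : R) (A : {set gT})
    (hk : 2 < k) (heps0 : 0 < eps) (heps1 : eps < 1)
    (hdelta : delta = (2 + k ^+ 2 * eps) / (k - 2))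
    (hdelta_le : delta <= 1 / 4)
    (hAG : A \subset G) (hA0 : A != set0) (hAinv : A = (A^-1)%g) :
  eps <= unif_prob R (setX A A) [pred p : gT * gT | (p.1 * p.2)%g \notin A]
  \/ exists A' : {set gT},
       [/\ A' \subset A,
           #|A :\: A'|%:R < 2 * #|A|%:R / k,
           group_set (A' * A')%g /\ (A' * A')%g \subset G
         & #|(A' * A')%g :\: A'|%:R <= delta / (1 - 2 * delta) * #|A'|%:R].
Proof.
have n0 : 0 < #|A|%:R :> R by rewrite ltr0n card_gt0.
have [|few] := lerP eps; first by left.
right.
have k0 : 0 < k by lra.
(* The mean of [escapes] over A is below eps|A|; a threshold k times larger makes |N| < |A|/k. *)
pose t := k * eps * #|A|%:R.
pose N := [set x in A | t <= (escapes A x)%:R].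
have ltN : #|N|%:R * k < #|A|%:R.
  have := markov_sum (S := A) t (fun x _ => ler0n R (escapes A x)).
  move: few; rewrite /unif_prob card_escaping_pairs cardsX natrM natr_sum.
  rewrite ltr_pdivrMr ?mulr_gt0 // -/N => lt_sum le_sum.
  have lt_N := le_lt_trans le_sum lt_sum.
  by rewrite -(ltr_pM2r (mulr_gt0 heps0 n0)); move: lt_N; rewrite /t; lra.
(* Removing N^-1 as well keeps B symmetric, at the price of the factor 2 in 2|A|/k. *)
pose B := A :\: (N :|: N^-1)%g.
have sBA : B \subset A by apply: subsetDl.
have Binv : B = (B^-1)%g.
  apply/setP => x; rewrite mem_invg !in_setD !in_setU !mem_invg invgK orbC.
  by rewrite -(mem_invg x A) -hAinv.
have ltAB : #|A :\: B|%:R < 2 * #|A|%:R / k.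
  rewrite ltr_pdivlMr //.
  have : (#|A :\: B| <= #|N| + #|N|)%N.
    rewrite -[X in (_ <= _ + X)%N]card_invg; apply: leq_trans (leq_card_setU _ _).
    apply/subset_leq_card/subsetP => x; rewrite /B !in_setD negb_and negbK.
    by case/andP => /orP[|/negP].
  by rewrite -(ler_nat R) natrD -(ler_pM2r k0); move: ltN; lra.
have cardB : #|B|%:R = #|A|%:R - #|A :\: B|%:R :> R.
  by rewrite -(cardsID B A) (setIidPr sBA) natrD addrK.
have deltaE : delta * (k - 2) = 2 + k ^+ 2 * eps.
  by rewrite hdelta divfK //; lra.
have ltABk : #|A :\: B|%:R * k < 2 * #|A|%:R by rewrite -ltr_pdivlMr.
have small x : x \in B -> (defect B x)%:R < delta * #|B|%:R.
  (* The defect at x is controlled by [escapes] at x^-1, which symmetry puts in B. *)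
  rewrite {1}Binv mem_invg => Bx.
  have : (escapes A x^-1%g)%:R < t.
    have := Bx; rewrite !inE negb_or => /andP[/andP[+ _] Ax].
    by rewrite Ax /= -ltNge.
  have : (defect B x)%:R <= (escapes A x^-1%g)%:R + #|A :\: B|%:R :> R.
    by rewrite -natrD ler_nat defect_le_escapes.
  rewrite cardB /t => le1 lt1.
  have d0 : 0 < delta.
    by rewrite hdelta divr_gt0 ?subr_gt0 ?addr_gt0 ?mulr_gt0 ?exprn_gt0.
  (* Times k, the defect is below (k^2 eps + 2)|A| = delta(k-2)|A|, and (k-2)|A| < k|B| because k|A
     \ B| < 2|A|. This is what fixes the value of delta. *)
  rewrite -(ltr_pM2r k0).
  suff : (k * eps * #|A|%:R) * k + #|A :\: B|%:R * k
      < delta * (#|A|%:R - #|A :\: B|%:R) * k by nra.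
  have -> : delta * (#|A|%:R - #|A :\: B|%:R) * k = delta * (k - 2) * #|A|%:R
      + delta * (2 * #|A|%:R - #|A :\: B|%:R * k) by ring.
  rewrite deltaE.
  have : 0 < delta * (2 * #|A|%:R - #|A :\: B|%:R * k) by rewrite mulr_gt0 ?subr_gt0.
  nra.
have B0 : B != set0.
  rewrite -card_gt0 -(ltr0n R) cardB -(pmulr_lgt0 _ k0); nra.
have [grp le_delta] := product_group_of_small_defect B0 Binv hdelta_le small.
exists B; split=> //; split=> //.
by rewrite mul_subG ?(subset_trans sBA).
Qed.
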